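(* Let $p\in(0,n)$, let $\Omega$ be a bounded convex domain in $\mathbb{R}^n$, and let $\nu$ be a Borel measure in $\Omega$. Assume either (i) $\nu=f\,d\mathcal{L}^n$ where $f\in C(\overline\Omega)$ with $f>0$ in $\overline\Omega$, or (ii) $\nu$ is compactly supported in $\Omega$. Let $u,v\in C(\overline\Omega)$ be convex functions satisfying: - $v<0$ in $\Omega$, $v\le0$ on $\partial\Omega$, and $\mu_v\ge|v|^p\nu$ in $\Omega$; - $u=0$ on $\partial\Omega$, and $\mu_u\le|u|^p\nu$ in $\Omega$. Then $u\ge v$ in $\Omega$, and consequently $\mu_u\le\mu_v$ in $\Omega$.
   Context: For a convex function $u$ on $\Omega$, the subdifferential is $\partial u(x)=\{q\in\mathbb{R}^n: u(y)\ge u(x)+q\cdot(y-x)\ \forall y\in\Omega\}$, and the Monge--Ampère measure is $\mu_u(S)=|\partial u(S)|$ (Lebesgue measure) for Borel $S\subset\Omega$, where $\partial u(S)=\bigcup_{x\in S}\partial u(x)$. $\mathcal{L}^n$ is $n$-dimensional Lebesgue measure. *)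

(* Defs.v *)
From HB Require Import structures.
From mathcomp Require Import all_boot all_order all_algebra.
From mathcomp Require Import all_classical all_reals all_analysis.

Set Implicit Arguments.
Unset Strict Implicit.
Unset Printing Implicit Defensive.
Import Order.TTheory GRing.Theory Num.Theory.
Import numFieldNormedType.Exports.
Local Open Scope classical_set_scope.
Local Open Scope ring_scope.

Section defs.
Context {R : realType} {n : nat}.
Local Notation Rn := 'rV[R]_n.

Definition borelRn := g_sigma_algebraType (@open Rn).

Definition dotp (x y : Rn) : R := \sum_(i < n) x 0 i * y 0 i.

Definition boundary (A : set Rn) : set Rn := closure A `\` interior A.

Definition bounded_convex_domain (Omega : set Rn) : Prop :=
  [/\ Omega !=set0, open Omega, connected Omega,
      bounded_set Omega & convex_set Omega].

Definition box (a b : Rn) : set Rn := [set x | forall i, a 0 i <= x 0 i <= b 0 i].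

(* Lebesgue measure on R^n, as the outer measure given by countable covers by
   closed boxes (for n = 0 every box has volume 1, so this is only meant for
   n > 0).  It is kept as a function on all subsets because the
   subgradient image of a Borel set is Lebesgue measurable, but not obviously
   Borel. *)
Definition lebesgueRn (A : set borelRn) : \bar R :=
  ereal_inf [set s | exists a b : nat -> Rn,
    [/\ forall k i, a k 0 i <= b k 0 i,
        A `<=` \bigcup_k box (a k) (b k) &
        s = (\sum_(k <oo) (\prod_(i < n) (b k 0 i - a k 0 i))%:E)%E]].

Definition subdifferential (Omega : set Rn) (u : Rn -> R) (x : Rn) : set Rn :=
  [set q | forall y, Omega y -> u x + dotp q (y - x) <= u y].

Definition monge_ampere (Omega : set Rn) (u : Rn -> R) (S : set borelRn) : \bar R :=
  lebesgueRn (\bigcup_(x in S) subdifferential Omega u x).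

(* A Borel measure in Omega is represented by a Borel measure on R^n of which
   only the values on subsets of Omega are used. *)

Definition le_measure_in (Omega : set Rn) (m1 m2 : set borelRn -> \bar R) : Prop :=
  forall S : set borelRn, measurable S -> S `<=` Omega -> (m1 S <= m2 S)%E.

Definition power_density (nu : set borelRn -> \bar R) (w : Rn -> R) (p : R)
    (S : set borelRn) : \bar R :=
  (\int[nu]_(x in S) (`|w x| `^ p)%:E)%E.

Definition has_positive_continuous_density (Omega : set Rn)
    (nu : set borelRn -> \bar R) : Prop :=
  exists f : Rn -> R,
    [/\ {within closure Omega, continuous f},
        forall x, closure Omega x -> 0 < f x &
        forall S : set borelRn, measurable S -> S `<=` Omega ->
          nu S = (\int[lebesgueRn]_(x in S) (f x)%:E)%E].

Definition support_in (Omega : set Rn) (nu : set borelRn -> \bar R) : set Rn :=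
  [set x | Omega x /\
    forall U : set Rn, open U -> U x -> (0 < nu (U `&` Omega))%E].

End defs.

Arguments borelRn : clear implicits.

(* Main.v *)
Require Import Defs.
From HB Require Import structures.
From mathcomp Require Import all_boot all_order all_algebra.
From mathcomp Require Import all_classical all_reals all_analysis.
From mathcomp Require Import ring lra.

Set Implicit Arguments.
Unset Strict Implicit.
Unset Printing Implicit Defensive.
Import Order.TTheory GRing.Theory Num.Theory.
Import numFieldNormedType.Exports.
Local Open Scope classical_set_scope.
Local Open Scope ring_scope.

(** Suppose that some multiple of [v] lies below [u], let [s] be the least factor
    with [s v <= u], and suppose [s > 1].  Take [t < s] with [s^p < t^n].  On the open set
    [A = {u + d < t v}] every subgradient of [t v] is a subgradient of [u] at some
    point of [A], so
    [t^n mu_v(A) <= mu_u(A) <= int_A |u|^p dnu <= s^p int_A |v|^p dnu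
     <= s^p mu_v(A)],
    while [0 < mu_u(A)] and [mu_v(A) < oo], which is absurd.

    It remains to find one multiple of [v] below [u].  If [nu] has compact support
    [K], a multiple below [u] on [K] works everywhere, since [mu_u] vanishes off [K].
    If [nu] has a positive continuous density, [v] is replaced by
    [l * v (x0 + s (x - x0))] with [s < 1 < l] close to 1: it is negative up to the
    boundary, and still a supersolution because the density is uniformly
    continuous and [p < n]. *)

(** * Lebesgue outer measure *)

Lemma cvgr_sum (R : realType) (T I : Type) (F : set_system T) (r : seq I)
    (f : I -> T -> R) (l : I -> R) : Filter F ->
  (forall i, f i x @[x --> F] --> l i) ->
  \sum_(i <- r) f i x @[x --> F] --> \sum_(i <- r) l i.
Proof.
move=> FF fl; apply: cvg_big => // -[x y].
by apply: cvgD; [exact: cvg_fst|exact: cvg_snd].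
Qed.

Lemma cvgr_prod (R : realType) (T I : Type) (F : set_system T) (r : seq I)
    (f : I -> T -> R) (l : I -> R) : Filter F ->
  (forall i, f i x @[x --> F] --> l i) ->
  \prod_(i <- r) f i x @[x --> F] --> \prod_(i <- r) l i.
Proof.
move=> FF fl; apply: cvg_big => // -[x y].
by apply: cvgM; [exact: cvg_fst|exact: cvg_snd].
Qed.

Section lebesgueRn.
Context {R : realType} {n : nat}.
Local Notation Rn := 'rV[R]_n.
Local Notation L := (@lebesgueRn R n).

Lemma le_lebesgueRn (A B : set Rn) : A `<=` B -> (L A <= L B)%E.
Proof.
move=> AB; apply: ereal_inf_le_tmp => _ [a [b [ab Bab ->]]].
by exists a, b; split => //; exact: subset_trans Bab.
Qed.

Lemma prod_side_ge0 (a b : Rn) : (forall i, a 0 i <= b 0 i) ->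
  0 <= \prod_(i < n) (b 0 i - a 0 i).
Proof. by move=> ab; apply: prodr_ge0 => i _; rewrite subr_ge0. Qed.

Lemma lebesgueRn_ge0 (A : set Rn) : (0 <= L A)%E.
Proof.
apply: le_ereal_inf_tmp => _ [a [b [ab _ ->]]].
by apply: nneseries_ge0 => k _ _; rewrite lee_fin prod_side_ge0.
Qed.

Lemma lebesgueRn_box (a b : Rn) : (0 < n)%N -> (forall i, a 0 i <= b 0 i) ->
  (L (box a b) <= (\prod_(i < n) (b 0 i - a 0 i))%:E)%E.
Proof.
move=> n0 ab; apply: ereal_inf_lbound.
(* The box itself, followed by degenerate boxes reduced to the point [a], whose volume vanishes
   because [n > 0]. *)
exists (fun=> a), (fun k => if k is 0%N then b else a); split.
- by move=> [|k] i //=.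
- by move=> x xab; exists 0%N.
- rewrite (@nneseries_split _ _ 0 1) => [|k _]; last first.
    by rewrite lee_fin; case: k => [|k]; apply: prod_side_ge0.
  rewrite big_nat1 eseries0 ?adde0// => -[|k]//= _ _.
  by rewrite (bigD1 (Ordinal n0))//= subrr mul0r.
Qed.

Lemma lebesgueRn0 : (0 < n)%N -> L set0 = 0%E.
Proof.
move=> n0; apply/eqP; rewrite eq_le lebesgueRn_ge0 andbT.
have := @lebesgueRn_box 0 0 n0 (fun=> lexx _).
rewrite [X in (_ <= X%:E)%E](bigD1 (Ordinal n0))//= subrr mul0r.
by apply: le_trans; exact: le_lebesgueRn.
Qed.

(** The inverse map [g] pulls a cover of the image back to a cover of [X] by boxes, with all volumes
    divided by [c ^+ n]. *)
Lemma lebesgueRn_affine (c : R) (d : Rn) (X : set Rn) : 0 < c ->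
  ((c ^+ n)%:E * L X <= L [set (c *: x + d)%R | x in X])%E.
Proof.
move=> c0; apply: le_ereal_inf_tmp => _ [a [b [ab Xab ->]]].
pose g (x : Rn) := c^-1 *: (x - d).
have gE x i : g x 0 i = c^-1 * (x 0 i - d 0 i) by rewrite !mxE.
have gab k i : g (a k) 0 i <= g (b k) 0 i.
  by rewrite !gE ler_pM2l ?invr_gt0// lerD2r.
have vol k : \prod_(i < n) (b k 0 i - a k 0 i) =
    c ^+ n * \prod_(i < n) (g (b k) 0 i - g (a k) 0 i).
  rewrite -[n in c ^+ n](card_ord n) -prodr_const -big_split/=.
  apply: eq_bigr => i _; rewrite !gE -mulrBr mulrA mulfV ?gt_eqF// mul1r.
  by rewrite opprB addrA subrK.
under eq_eseriesr do rewrite vol EFinM.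
rewrite nneseriesZl; last by move=> k _; rewrite lee_fin prod_side_ge0.
rewrite lee_pmul2l ?lte_fin ?exprn_gt0//; apply: ereal_inf_lbound.
exists (g \o a), (g \o b); split => // x Xx.
have [k _ xk] := Xab _ (ex_intro2 _ _ x Xx erefl); exists k => // i.
have := xk i; rewrite !gE !mxE => /andP[h1 h2].
by rewrite ler_pdivrMl// ler_pdivlMl// lerBlDr h1 lerBrDr.
Qed.

Lemma lattice_points_segment (a r s t : R) (M : nat) : s <= t -> 0 < r ->
  \sum_(j < M) (r * (s <= a + r * j%:R <= t)%R%:R) <= t - s + r.
Proof.
(* Each lattice point of [s, t] contributes an increment [r] of the clamp [g]. *)
move=> st r0; pose g (x : R) := Num.max s (Num.min x (t + r)).
pose x (j : nat) := a + r * j%:R.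
have gm y z : y <= z -> g y <= g z.
  by move=> yz; rewrite /g; do 2 (rewrite /Num.max /Num.min; repeat case: ifPn); lra.
have gs j : r * (s <= x j <= t)%R%:R <= g (x j.+1) - g (x j).
  have xS : x j.+1 = x j + r by rewrite /x -natr1; ring.
  case: (boolP (_ <= _ <= _)) => [/andP[h1 h2]|_].
    rewrite xS mulr1 /g !min_l ?max_r; lra.
  by rewrite mulr0 subr_ge0 gm// xS lerDl ltW.
apply: (@le_trans _ _ (\sum_(0 <= j < M) (g (x j.+1) - g (x j)))).
  by rewrite big_mkord; apply: ler_sum => j _; exact: gs.
rewrite telescope_sumr//.
have : s <= g (x 0) by rewrite le_max lexx.
have : g (x M) <= t + r by rewrite ge_max ge_min lexx orbT andbT; lra.
lra.
Qed.

(* Count, in each box of the cover, the points of the lattice of mesh [r / M]. *)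
Lemma volume_cover_lattice (c : Rn) (r : R) (N M : nat) (a b : nat -> Rn) :
  0 < r -> (0 < M)%N -> (forall k i, a k 0 i <= b k 0 i) ->
  box c (c + const_mx r) `<=` \bigcup_(k < N) box (a k) (b k) ->
  r ^+ n <= \sum_(k < N) \prod_(i < n) (b k 0 i - a k 0 i + r / M%:R).
Proof.
move=> r0 M0 ab cover; pose h := r / M%:R.
have M0' : 0 < M%:R :> R by rewrite ltr0n.
have h0 : 0 < h by rewrite divr_gt0.
pose pt (z : {ffun 'I_n -> 'I_M}) : Rn := \row_i (c 0 i + h * (z i)%:R).
pose F k i (j : 'I_M) : R :=
  h * (a k 0 i <= c 0 i + h * j%:R <= b k 0 i)%R%:R.
have F0 k i j : 0 <= F k i j by rewrite mulr_ge0// ltW.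
have -> : r ^+ n = \sum_(z : {ffun 'I_n -> 'I_M}) h ^+ n.
  rewrite sumr_const card_ffun !card_ord -mulr_natr natrX -exprMn.
  by rewrite /h divfK// gt_eqF.
(* Each lattice point lies in some box of the cover, and for that box the product of the
   [F k i (z i)] is the full cell volume [h ^+ n]. *)
apply: (@le_trans _ _ (\sum_(z : {ffun 'I_n -> 'I_M}) \sum_(k < N)
    \prod_(i < n) F k i (z i))).
  apply: ler_sum => z _.
  have /cover[k kN zk] : box c (c + const_mx r) (pt z).
    move=> i; rewrite !mxE; apply/andP; split; first by rewrite lerDl mulr_ge0// ltW.
    rewrite lerD2l.
    rewrite /h -mulrA ler_piMr// ?(ltW r0)// mulrC ler_pdivrMr// mul1r.
    by rewrite ler_nat ltnW.
  rewrite (bigD1 (Ordinal kN))//= -[leLHS]addr0 lerD//; last first.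
    by apply: sumr_ge0 => j _; apply: prodr_ge0.
  rewrite -[X in h ^+ X](card_ord n) -prodr_const; apply: ler_prod => i _.
  by rewrite (ltW h0)/= /F; have := zk i; rewrite mxE => ->; rewrite mulr1.
rewrite exchange_big/=; apply: ler_sum => k _.
(* For a fixed box, the sum over lattice points factors into one-dimensional counts. *)
rewrite -(bigA_distr_bigA (fun i j => F k i j)).
apply: ler_prod => i _; rewrite sumr_ge0//=.
exact: lattice_points_segment.
Qed.

(** The lattice count overestimates each side by one mesh; the mesh now tends to zero. *)
Lemma volume_cover_finite (c : Rn) (r : R) (N : nat) (a b : nat -> Rn) :
  0 < r -> (forall k i, a k 0 i <= b k 0 i) ->
  box c (c + const_mx r) `<=` \bigcup_(k < N) box (a k) (b k) ->
  r ^+ n <= \sum_(k < N) \prod_(i < n) (b k 0 i - a k 0 i).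
Proof.
move=> r0 ab cover.
pose g (e : R) := \sum_(k < N) \prod_(i < n) (b k 0 i - a k 0 i + e).
have gc : {for 0, continuous g}.
  rewrite /g; apply: cvgr_sum => k; apply: cvgr_prod => i.
  by apply: cvgD; [exact: cvg_cst|exact: cvg_id].
have g0 : g 0 = \sum_(k < N) \prod_(i < n) (b k 0 i - a k 0 i).
  by apply: eq_bigr => k _; apply: eq_bigr => i _; rewrite addr0.
have hM : (fun M : nat => r / M.+1%:R) @ \oo --> (0 : R).
  rewrite -[X in _ --> X](mulr0 r); apply: cvgM; first exact: cvg_cst.
  exact: cvg_harmonic.
rewrite -g0; apply: (@cvgr_to_ge nat \oo _ _ (fun M : nat => g (r / M.+1%:R))).
  by apply: continuous_cvg; [exact: gc|exact: hM].
by apply: nearW => M; rewrite /g; apply: (@volume_cover_lattice c r N M.+1).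
Qed.

Lemma box_compact (a b : Rn) : compact (box a b).
Proof.
have := @rV_compact R n (fun i => `[a 0 i, b 0 i]%classic)
  (fun=> @segment_compact R _ _).
by rewrite (_ : [set v : Rn | _] = box a b); [apply | apply/seteqP; split].
Qed.

Lemma box_fatten (a b : Rn) (e : R) : 0 < e -> exists2 d : R, 0 < d &
  \prod_(i < n) ((b + const_mx d) 0 i - (a - const_mx d) 0 i) <=
  \prod_(i < n) (b 0 i - a 0 i) + e.
Proof.
move=> e0; pose g (d : R) := \prod_(i < n) (b 0 i - a 0 i + (d + d)).
have gc : {for 0, continuous g}.
  rewrite /g; apply: cvgr_prod => i.
  by apply: cvgD; [exact: cvg_cst|apply: cvgD; exact: cvg_id].
have g0 : g 0 = \prod_(i < n) (b 0 i - a 0 i).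
  by apply: eq_bigr => i _; rewrite !addr0.
have /nbhs_ballP[d /= d0 dP] : \forall x \near (0 : R), g x <= g 0 + e.
  by apply: (@cvgr_le _ _ _ _ g (g 0) gc); rewrite ltrDl.
exists (d / 2); first lra.
have : g (d / 2) <= g 0 + e.
  by apply: dP; rewrite /ball/= sub0r normrN gtr0_norm; lra.
rewrite g0; apply: le_trans; rewrite le_eqVlt; apply/orP; left; apply/eqP.
by apply: eq_bigr => i _; rewrite !mxE; ring.
Qed.

(** Fattening the [k]-th box of a cover at cost [e / 2 ^ k.+1] makes the interiors cover the compact
    cube, so finitely many boxes suffice and the finite estimate applies. *)
Lemma lebesgueRn_cube (c : Rn) (r : R) (A : set Rn) : 0 < r ->
  box c (c + const_mx r) `<=` A -> ((r ^+ n)%:E <= L A)%E.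
Proof.
move=> r0 cA; apply: le_ereal_inf_tmp => _ [a [b [ab Aab ->]]].
apply/lee_addgt0Pr => e e0.
have /choice[d dP] k : exists d : R, 0 < d /\
    \prod_(i < n) ((b k + const_mx d) 0 i - (a k - const_mx d) 0 i) <=
    \prod_(i < n) (b k 0 i - a k 0 i) + e / (2 ^ k.+1)%:R.
  have [|d d0 dP] := @box_fatten (a k) (b k) (e / (2 ^ k.+1)%:R).
    by rewrite divr_gt0// ltr0n expn_gt0.
  by exists d.
pose a' k := a k - const_mx (d k); pose b' k := b k + const_mx (d k).
have ab' k i : a' k 0 i <= b' k 0 i.
  by rewrite !mxE; have := ab k i; have [] := dP k; lra.
have [N cN] : exists N, box c (c + const_mx r) `<=`
    \bigcup_(k < N) box (a' k) (b' k).
  have := @box_compact c (c + const_mx r); rewrite compact_cover.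
  move=> /(_ nat setT (fun k => (box (a' k) (b' k))^°)).
  case=> [k _|x /cA/Aab[k _ xk]|D _ Dcov]; first exact: open_interior.
    exists k => //; have [d0 _] := dP k.
    apply/nbhs_ballP; exists (d k) => //= y [_ xy] i.
    have := xy 0 i; have := xk i; rewrite !mxE /ball/= ltr_distl.
    by move=> /andP[? ?] /andP[? ?]; apply/andP; split; lra.
  (* A strict upper bound for the indices in the finite subcover. *)
  exists (\max_(k <- finmap.enum_fset D) k.+1)%N => x /Dcov[k kD xk].
  exists k; last exact: interior_subset xk.
  exact: (@leq_bigmax_seq _ (finmap.enum_fset D) predT (fun k => k.+1) k kD).
have vol0 k : (0 <= (\prod_(i < n) (b k 0 i - a k 0 i))%:E)%E.
  by rewrite lee_fin prod_side_ge0.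
apply: (le_trans _ (epsilon_trick xpredT vol0 (ltW e0))).
apply: le_trans (nneseries_lim_ge N _); last first.
  move=> k _ _; rewrite -EFinD lee_fin addr_ge0 ?prod_side_ge0//.
  by rewrite divr_ge0 ?ltW.
rewrite big_mkord; under eq_bigr do rewrite -EFinD.
rewrite sumEFin lee_fin.
apply: le_trans (@volume_cover_finite c r N a' b' r0 ab' cN) _.
by apply: ler_sum => k _; have [] := dP k.
Qed.

End lebesgueRn.

(** * Integrals against set functions *)

(* [lebesgueRn] is only an outer measure, so the integral is handled through its
   definition as a supremum over simple functions, for arbitrary set functions. *)
Section setfun_integral.
Context d (T : measurableType d) (R : realType).
Implicit Types (m : set T -> \bar R) (f : T -> R).

Lemma sintegral_setfun_range m (h : T -> R) : m set0 = 0%E ->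
  sintegral m h = (\sum_(x \in range h) x%:E * m (h @^-1` [set x]))%E.
Proof.
move=> m0; rewrite sintegralET (fsbig_widen (range h) setT)//= => x [_ Nfx] /=.
by rewrite preimage10// m0 mule0.
Qed.

Import HBNNSimple.

(** The only nonnegative simple function below zero is zero itself, so the negative part contributes
    nothing once [m set0 = 0]. *)
Lemma integral_setfunE m (D : set T) f : m set0 = 0%E ->
  (forall x, D x -> 0 <= f x) ->
  (\int[m]_(x in D) (f x)%:E)%E = ereal_sup [set sintegral m h |
    h in [set h : {nnsfun T >-> R} |
      forall x, ((h x)%:E <= ((EFin \o f) \_ D) x)%E]].
Proof.
move=> m0 f0; rewrite /integral funeneg_restrict funepos_restrict.
have /eq_restrictP-> := ge0_funeposE (f := EFin \o f) f0.
have /eq_restrictP-> := ge0_funenegE (f := EFin \o f) f0.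
rewrite erestrict0 [X in (_ - X)%E](_ : _ = 0%E) ?sube0//.
have s0 : sintegral m (cst 0) = 0%E.
  rewrite sintegral_setfun_range// fsbig1// => _ [y _ <-].
  by rewrite mul0e.
apply/eqP; rewrite eq_le; apply/andP; split.
  apply: ge_ereal_sup => _ [h /= h0 <-].
  rewrite (_ : h = cst 0 :> (T -> R)) ?s0//.
  apply/funext => x; apply/eqP; rewrite eq_le fun_ge0 andbT.
  by have := h0 x; rewrite lee_fin.
by apply: ereal_sup_ubound; exists nnsfun0 => //=; exact: s0.
Qed.

Lemma nnsfun_scale_comp (h : {nnsfun T >-> R}) (psi : T -> T) (k : R) :
  measurable_fun setT psi -> 0 <= k ->
  exists h' : {nnsfun T >-> R}, forall x, h' x = k * h (psi x).
Proof.
move=> mpsi k0.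
have mh : measurable_fun setT (h \o psi) by exact: measurableT_comp.
have fh : finite_set (range (h \o psi)).
  apply: (sub_finite_set (B := range h)); last exact: fimfunP.
  by move=> _ [x _ <-]; exists (psi x).
have h0 x : 0 <= (h \o psi) x by exact: fun_ge0.
pose h1 : {nnsfun T >-> R} := HB.pack (h \o psi)
  (@isMeasurableFun.Build _ _ T R _ mh) (@FiniteImage.Build _ _ _ fh)
  (@isNonNegFun.Build _ _ _ h0).
by exists (scale_nnsfun h1 k0).
Qed.

(** A change of variables in the form of an inequality: a simple function [h] below [f1] is
    transported to [k1 * h (psi x)], which is below [f2]. With [psi] the identity it compares
    integrands or measures; with [psi] a dilation it rescales the domain. *)
Lemma le_integral_bijection m1 m2 (phi psi : T -> T) (S : set T)
    (f1 f2 : T -> R) (k1 k2 : R) :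
  m1 set0 = 0%E -> m2 set0 = 0%E ->
  (forall B, 0 <= m1 B)%E ->
  cancel phi psi -> cancel psi phi -> measurable_fun setT psi ->
  0 < k1 -> 0 < k2 ->
  (forall x, S x -> 0 <= f1 x) ->
  (forall x, S x -> k1 * f1 x <= f2 (phi x)) ->
  (forall B, measurable B -> B `<=` S ->
    (k2%:E * m1 B <= m2 (psi @^-1` B))%E) ->
  ((k1 * k2)%:E * \int[m1]_(x in S) (f1 x)%:E <=
    \int[m2]_(x in psi @^-1` S) (f2 x)%:E)%E.
Proof.
move=> m10 m20 m1_ge0 phiK psiK mpsi k10 k20 f10 f12 m12.
have f20 x : (psi @^-1` S) x -> 0 <= f2 x.
  move=> /= Sx; rewrite -[x]psiK; apply: le_trans (f12 _ Sx).
  by rewrite mulr_ge0 ?f10// ltW.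
have k12 : 0 < k1 * k2 by rewrite mulr_gt0.
rewrite !integral_setfunE// -lee_pdivlMl//; apply: ge_ereal_sup => _ [h /= hf <-].
rewrite lee_pdivlMl//.
have [h' h'E] := nnsfun_scale_comp h mpsi (ltW k10).
apply: (@le_trans _ _ (sintegral m2 h')); last first.
  apply: ereal_sup_ubound; exists h' => //= x; rewrite h'E.
  have := hf (psi x); have [Sx|Sx] := pselect (S (psi x)).
    rewrite !patchT ?inE// !lee_fin => hx.
    apply: (@le_trans _ _ (k1 * f1 (psi x))); first by rewrite ler_pM2l.
    by rewrite -{2}[x]psiK; exact: f12.
  by rewrite !patchN ?notin_setE// !lee_fin pmulr_rle0.
(* Multiplication by [k1] matches the values of [h] with those of [h'], and the level sets
   correspond under [psi]. *)
have hE : forall x, h' @^-1` [set k1 * x] = psi @^-1` (h @^-1` [set x]).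
  move=> x; apply/seteqP; split => y /=; rewrite h'E.
    by move/(mulfI (lt0r_neq0 k10)).
  by move->.
rewrite [leRHS]sintegralET (reindex_fsbigT ( *%R k1))/=; last first.
  by exists ( *%R k1^-1); [apply: mulKf|apply: mulVKf]; exact: lt0r_neq0.
rewrite -(fsbig_widen (range h) setT)//=; last first.
  move=> x [_ Nfx] /=; rewrite hE preimage10//.
  by rewrite preimage_set0 m20 mule0.
rewrite sintegral_setfun_range//.
have hfin : finite_set (range h) by exact: fimfunP.
rewrite ge0_mule_fsumr; last first.
  move=> x; have [x0|x0] := leP 0 x; first by rewrite mule_ge0.
  rewrite preimage10 ?m10 ?mule0// => -[y _ hy].
  have hy0 : 0 <= h y by exact: fun_ge0.
  by move: hy0; rewrite hy leNgt x0.
apply: lee_fsum => [//|] x [y _ <-]; rewrite hE.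
have hy0 : 0 <= h y by exact: fun_ge0.
  (* The value [0] contributes nothing to either sum; a positive value of [h] is taken only inside
     [S], where [m12] applies. *)
  move: hy0; rewrite le_eqVlt => /orP[/eqP<-|hy].
  by rewrite mulr0 !mul0e mule0.
rewrite [(k1 * h y)%:E]EFinM -muleA EFinM -muleA lee_pmul2l ?lte_fin//.
rewrite muleCA lee_pmul2l ?lte_fin//; apply: m12 => //.
move=> z /= hz; apply: contrapT => Sz.
by have := hf z; rewrite hz patchN ?notin_setE// lee_fin leNgt hy.
Qed.

End setfun_integral.

(** * Row vectors and convexity *)

Section row_vectors.
Context {R : realType} {n : nat}.
Local Notation Rn := 'rV[R]_n.
Implicit Types (x y q : Rn) (Omega : set Rn).

Lemma norm_coord_le x i : `|x 0 i| <= `|x|.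
Proof.
rewrite [leRHS]/Num.norm /= mx_normrE; apply/bigmax_geP; right => /=.
by exists (0, i).
Qed.

Lemma norm_rV_lt x (r : R) : 0 < r -> (forall i, `|x 0 i| < r) -> `|x| < r.
Proof.
move=> r0 xr; rewrite [ltLHS]/Num.norm /= mx_normrE; apply/bigmax_ltP; split => //.
by move=> [i j] _ /=; rewrite (ord1 i).
Qed.

Lemma dotpDl q q' x : dotp (q + q') x = dotp q x + dotp q' x.
Proof. by rewrite -big_split; apply: eq_bigr => i _; rewrite mxE mulrDl. Qed.

Lemma dotpDr q x y : dotp q (x + y) = dotp q x + dotp q y.
Proof. by rewrite -big_split; apply: eq_bigr => i _; rewrite mxE mulrDr. Qed.

Lemma dotpZr (c : R) q x : dotp q (c *: x) = c * dotp q x.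
Proof. by rewrite /dotp mulr_sumr; apply: eq_bigr => i _; rewrite mxE mulrCA. Qed.

Lemma dotpZl (c : R) q x : dotp (c *: q) x = c * dotp q x.
Proof. by rewrite /dotp mulr_sumr; apply: eq_bigr => i _; rewrite mxE mulrA. Qed.

Lemma dotpC x y : dotp x y = dotp y x.
Proof. by apply: eq_bigr => i _; rewrite mulrC. Qed.

Lemma dotpNr q x : dotp q (- x) = - dotp q x.
Proof. by rewrite -scaleN1r dotpZr mulN1r. Qed.

(** The norm on row vectors is the maximum norm, whence the factor [n]. *)
Lemma dotp_le q x : `|dotp q x| <= n%:R * `|q| * `|x|.
Proof.
apply: le_trans (ler_norm_sum _ _ _) _.
rewrite -mulrA mulr_natl -[X in _ *+ X](card_ord n) -sumr_const.
by apply: ler_sum => i _; rewrite normrM ler_pM ?norm_coord_le.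
Qed.

Lemma sqr_coord_le_dotp x i : x 0 i ^+ 2 <= dotp x x.
Proof.
rewrite /dotp (bigD1 i)//= -expr2 lerDl.
by apply: sumr_ge0 => j _; rewrite -expr2 sqr_ge0.
Qed.

Lemma dotp_ge0 x : 0 <= dotp x x.
Proof. by apply: sumr_ge0 => j _; rewrite -expr2 sqr_ge0. Qed.

Lemma dotp_delta q (c : R) (i : 'I_n) : dotp q (c *: delta_mx 0 i) = c * q 0 i.
Proof.
rewrite dotpZr /dotp (bigD1 i)//= !mxE !eqxx mulr1 big1 ?addr0// => j ji.
by rewrite mxE eqxx (negPf ji) mulr0.
Qed.

Lemma norm_delta_le (c : R) (i : 'I_n) : `|c *: delta_mx 0 i : Rn| <= `|c|.
Proof.
rewrite normrZ ler_piMr//.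
rewrite [leLHS]/Num.norm /= mx_normrE; apply/bigmax_leP; split => //=.
by move=> [k j] _ /=; rewrite mxE; case: (_ && _); rewrite ?normr1 ?normr0.
Qed.

Lemma continuous_dotp q : continuous (fun x => dotp q x).
Proof.
move=> x; apply: (@cvgr_sum _ _ _ (nbhs x)) => i; apply: cvgM; first exact: cvg_cst.
exact: coord_continuous.
Qed.

Lemma continuous_affine (c : R) q : continuous (fun x => c + dotp q x).
Proof.
move=> x; apply: (@cvgD _ _ _ (nbhs x)); first exact: cvg_cst.
exact: continuous_dotp.
Qed.

Lemma convex_function_le Omega (u : Rn -> R) x y (t : R) :
  convex_function Omega u -> Omega x -> Omega y -> 0 <= t <= 1 ->
  u (t *: x + (1 - t) *: y) <= t * u x + (1 - t) * u y.
Proof.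
move=> cu Ox Oy /andP[t0 t1].
have it : Itv.spec (@Itv.num_sem R) (Itv.Real `[0%Z, 1%Z]) t.
  by apply/andP; split; rewrite ?num_real// in_itv/= t0 t1.
have := cu (Itv.mk it) x y; rewrite !inE => /(_ Ox Oy).
by [].
Qed.

Lemma convex_set_conv Omega x y (t : R) :
  convex_set Omega -> Omega x -> Omega y -> 0 <= t <= 1 ->
  Omega (t *: x + (1 - t) *: y).
Proof.
move=> cO Ox Oy /andP[t0 t1].
have it : Itv.spec (@Itv.num_sem R) (Itv.Real `[0%Z, 1%Z]) t.
  by apply/andP; split; rewrite ?num_real// in_itv/= t0 t1.
have := cO x y (Itv.mk it); rewrite !inE => /(_ Ox Oy).
by [].
Qed.

Lemma closure_boundary Omega x : open Omega -> closure Omega x ->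
  Omega x \/ boundary Omega x.
Proof.
move=> oO Cx; have [?|Ox] := pselect (Omega x); first by left.
right; split => //; by move/interior_subset.
Qed.

Lemma bounded_closure_compact Omega : bounded_set Omega ->
  compact (closure Omega).
Proof.
move=> bO; apply: bounded_closed_compact; last exact: closed_closure.
move: bO => [M [Mr bM]]; exists M; split => // N MN x.
have cN : closed [set y : Rn | `|y| <= N].
  apply: (@closed_comp _ _ (fun y : Rn => `|y|) [set z : R | z <= N]).
    by move=> y _; exact: norm_continuous.
  exact: closed_le.
have ON : Omega `<=` [set y : Rn | `|y| <= N] by exact: bM.
by move=> Cx; have := closureS ON Cx; rewrite -(closure_id _).1.
Qed.
End row_vectors.

(** * Touching a convex function from below *)

Section within_continuity.
Context {R : realType} {T : topologicalType}.
Implicit Types (K : set T) (f g : T -> R).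

Lemma within_gt0 K f x : {within K, continuous f} -> K x -> 0 < f x ->
  \forall y \near x, K y -> 0 < f y.
Proof.
move=> /subspace_continuousP/(_ x) + Kx fx => /(_ Kx) cf.
exact: (cvgr_gt (f x) cf).
Qed.

Lemma within_continuousB K f g : {within K, continuous f} ->
  {within K, continuous g} -> {within K, continuous (f \- g)}.
Proof. by move=> cf cg x; apply: continuousB; [exact: cf|exact: cg]. Qed.

Lemma within_le_closure K (A : set T) f g : {within K, continuous f} ->
  {within K, continuous g} -> A `<=` K -> (forall x, A x -> f x <= g x) ->
  forall x, K x -> closure A x -> f x <= g x.
Proof.
move=> cf cg AK fg x Kx cAx; rewrite leNgt; apply/negP => gf.
have /(_ Kx) := @within_gt0 K (f \- g) x (within_continuousB cf cg).
rewrite /= subr_gt0 => /(_ gf)/cAx[y [Ay /(_ (AK _ Ay))]].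
by rewrite subr_gt0 ltNge fg.
Qed.

Lemma within_le_closed K f g : closed K -> {within K, continuous f} ->
  {within K, continuous g} -> closed [set x | K x /\ f x <= g x].
Proof.
move=> clK cf cg x cx.
have Kx : K x by apply: clK; apply: closureS cx => y [].
split => //.
by apply: (within_le_closure cf cg (A := [set x | K x /\ f x <= g x])) => // y [].
Qed.

Lemma continuous_within K f : continuous f -> {within K, continuous f}.
Proof. exact: continuous_subspaceT. Qed.

End within_continuity.

(** Near each point of [C], half the radius of a ball contained in [O] serves for all nearby points;
    compactness makes the radius uniform. *)
Lemma compact_ball_subset {R : realType} {V : normedModType R} (C O : set V) :
  compact C -> open O -> C `<=` O ->
  exists2 r : R, 0 < r & forall x y, C x -> `|x - y| < r -> O y.
Proof.
move=> /compact_near_coveringP cC oO CO.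
have := cC R (0^'+)%R (fun r x => forall y, `|x - y| < r -> O y) _.
case=> [x Cx|].
  have /nbhs_ballP[e /= e0 eO] : nbhs x O by apply: open_nbhs_nbhs; split => //; exact: CO.
  exists (ball x (e / 2), [set r | r < e / 2]) => /=.
    split; first by apply: nbhsx_ballx; rewrite divr_gt0.
    by apply: nbhs_right_lt; rewrite divr_gt0.
  move=> [x' r] /= [xx' re] y x'y; apply: eO.
  rewrite -ball_normE/= [e]splitr (le_lt_trans (ler_distD x' _ _))//.
  rewrite ltrD// ?(lt_trans x'y re)//.
  by move: xx'; rewrite -ball_normE.
move=> e /= e0 eP; exists (e / 2); first by rewrite divr_gt0.
move=> x y Cx; apply: eP => //; last by rewrite divr_gt0.
by rewrite /ball_/= sub0r normrN gtr0_norm; lra.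
Qed.

Section sliding.
Context {R : realType} {n : nat}.
Local Notation Rn := 'rV[R]_n.
Variable Omega : set Rn.
Hypotheses (oO : open Omega) (bO : bounded_set Omega).
Local Notation clO := (closure Omega).

(* Lower the affine function until it touches the graph of [u] from below. *)
Lemma subdifferential_slide (u : Rn -> R) (q : Rn) (c eta : R) (x : Rn) :
  {within clO, continuous u} -> Omega x ->
  (forall y, boundary Omega y -> c + dotp q y <= u y + eta) ->
  u x + eta < c + dotp q x ->
  exists y, [/\ Omega y, subdifferential Omega u y q &
    u y - (c + dotp q y) <= u x - (c + dotp q x)].
Proof.
move=> cu Ox bdl xl.
pose l (y : Rn) := c + dotp q y.
have cl : {within clO, continuous l}.
  exact/continuous_within/continuous_affine.
have Cx : clO x by exact: subset_closure.
have [] := compact_EVT_min (ex_intro _ x Cx) (bounded_closure_compact bO)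
  (within_continuousB cu cl).
move=> y; rewrite inE => Cy ymin.
have yx : u y - l y <= u x - l x by apply: ymin; rewrite inE.
exists y; have Oy : Omega y.
  have [//|By] := closure_boundary oO Cy.
  by have := bdl y By; move: yx; rewrite /l; lra.
split => // z Oz; have /= := ymin z.
rewrite inE => /(_ (subset_closure Oz)).
by rewrite /l dotpDr dotpNr; lra.
Qed.

(** Continuity extends the subgradient inequality to the boundary, where supporting planes are
    compared with boundary values. *)
Lemma subdifferential_closure (w : Rn -> R) (x q y : Rn) :
  {within clO, continuous w} -> subdifferential Omega w x q -> clO y ->
  w x - dotp q x + dotp q y <= w y.
Proof.
move=> cw qw Cy; apply: (@within_le_closure _ _ clO Omega
  (fun y => w x - dotp q x + dotp q y) w) => //.
- exact/continuous_within/continuous_affine.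
- exact: subset_closure.
- by move=> z /qw; rewrite dotpDr dotpNr; lra.
Qed.

(** The supporting plane of [w] at [x] is at most [0 = u] on the boundary but exceeds [u + d] at
    [x]. Slid down until it touches [u], it does so where the gap is at least as large as at [x],
    and there [w] lies above the original plane. *)
Lemma subdifferential_contact (u w : Rn -> R) (d : R) (x q : Rn) :
  0 <= d -> {within clO, continuous u} -> {within clO, continuous w} ->
  (forall y, boundary Omega y -> u y = 0) ->
  (forall y, boundary Omega y -> w y <= 0) ->
  Omega x -> u x + d < w x -> subdifferential Omega w x q ->
  exists y, [/\ Omega y, u y + d < w y & subdifferential Omega u y q].
Proof.
move=> d0 cu cw u0 w0 Ox xd qw.
have lw := subdifferential_closure cw qw.
have [y By||y [Oy qu yx]] := @subdifferential_slide u q (w x - dotp q x) 0 x cu Ox.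
- by have := w0 y By; rewrite (u0 y By); have := lw _ By.1; lra.
- lra.
exists y; split => //.
by have := lw _ (subset_closure Oy); lra.
Qed.

Lemma contact_open (u w : Rn -> R) (d : R) :
  {within clO, continuous u} -> {within clO, continuous w} ->
  open [set y | Omega y /\ u y + d < w y].
Proof.
move=> cu cw; rewrite openE => x [Ox xd].
have cd : {within clO, continuous (fun y => w y - u y - d)}.
  apply: (within_continuousB (f := fun y => w y - u y)); first exact: within_continuousB.
  exact/continuous_within/cst_continuous.
have := within_gt0 cd (subset_closure Ox); rewrite -addrA -opprD subr_gt0.
move=> /(_ xd) nx; have nO : nbhs x Omega by exact: open_nbhs_nbhs.
apply: filterS2 nO nx => y Oy /(_ (subset_closure Oy)).
by rewrite -addrA -opprD subr_gt0.
Qed.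

(** Steps of length [r / 2] along the axes from [C] stay in [Omega], where [|w| <= M]; this bounds
    each coordinate of a subgradient by [B], so all of them lie in one cube. *)
Lemma subdifferential_bounded (w : Rn -> R) (C : set Rn) :
  (0 < n)%N -> {within clO, continuous w} -> compact C -> C `<=` Omega ->
  (lebesgueRn (\bigcup_(x in C) subdifferential Omega w x) < +oo)%E.
Proof.
move=> n0 cw cC CO.
have [r r0 rO] := compact_ball_subset cC oO CO.
have [M M0 wM] : exists2 M, 0 < M & forall x, Omega x -> `|w x| <= M.
  have /ex_strict_bound_gt0[M M0 MP] : bounded_set (w @` clO).
    by apply/compact_bounded/continuous_compact => //; exact: bounded_closure_compact.
  exists M => // x /subset_closure Ox; apply/ltW/MP; exact: imageP.
pose B := (M + M) / (r / 2).
have B0 : 0 <= B by rewrite divr_ge0//; lra.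
apply: (@le_lt_trans _ _ (lebesgueRn (box (- const_mx B) (const_mx B)))); last first.
  apply: le_lt_trans (lebesgueRn_box n0 _) _; last exact: ltry.
  by move=> i; rewrite !mxE; lra.
apply: le_lebesgueRn => q [x Cx qx] i; rewrite !mxE.
have key s : `|s| = r / 2 -> s * q 0 i <= M + M.
  move=> sr; have Oy : Omega (x + s *: delta_mx 0 i).
    apply: (rO x) => //; rewrite opprD addrA subrr sub0r normrN.
    by rewrite (le_lt_trans (norm_delta_le _ _))// sr; lra.
  have := qx _ Oy; rewrite addrAC subrr add0r dotp_delta.
  have := wM _ (CO _ Cx); have := wM _ Oy; rewrite !ler_norml; lra.
have r20 : 0 < r / 2 by lra.
have := key (r / 2); have := key (- (r / 2)).
rewrite normrN gtr0_norm// => /(_ erefl) h1 /(_ erefl) h2.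
by rewrite /B lerNl !ler_pdivlMr//; apply/andP; split; lra.
Qed.

End sliding.

(** * Existence of subgradients and positive measure of the contact image *)

Section subgradients.
Context {R : realType} {n : nat}.
Local Notation Rn := 'rV[R]_n.
Variable Omega : set Rn.
Hypotheses (oO : open Omega) (bO : bounded_set Omega).
Local Notation clO := (closure Omega).

(* A convex function touched from below by a concave paraboloid is also above
   the tangent plane: compare along the segment from [z] to [y] and let the
   quadratic term vanish. *)
Lemma convex_above_paraboloid (w : Rn -> R) (z q : Rn) (M e : R) :
  convex_function Omega w -> Omega z -> 0 <= M -> 0 < e ->
  (forall y, `|y - z| < e ->
    w z + dotp q (y - z) - M * dotp (y - z) (y - z) <= w y) ->
  subdifferential Omega w z q.
Proof.
move=> cw Oz M0 e0 wM y Oy; rewrite leNgt; apply/negP => gap.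
pose g := w z + dotp q (y - z) - w y.
have g0 : 0 < g by rewrite /g subr_gt0.
pose D := dotp (y - z) (y - z); have D0 : 0 <= D by exact: dotp_ge0.
pose K := `|y - z| + 1; have K0 : 0 < K by rewrite /K ltr_wpDl.
pose P := M * D + 1; have P0 : 0 < P by rewrite /P ltr_wpDl// mulr_ge0.
(* Small enough that the point of the segment is within [e] of [z] and that the quadratic loss
   [t * (M * D)] stays below the gap [g]. *)
pose t := Num.min 1 (Num.min (e / 2 / K) (g / 2 / P)).
have t0 : 0 < t by rewrite !lt_min ltr01 !divr_gt0.
have t1 : t <= 1 by rewrite ge_min lexx.
have tK : t * K <= e / 2 by rewrite -ler_pdivlMr// !ge_min lexx !orbT.
have tP : t * P <= g / 2 by rewrite -ler_pdivlMr// !ge_min lexx !orbT.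
have yt : t *: y + (1 - t) *: z - z = t *: (y - z).
  by apply/rowP => i; rewrite !mxE; ring.
have st : `|t *: y + (1 - t) *: z - z| < e.
  rewrite yt normrZ gtr0_norm// (le_lt_trans (y := t * K))//.
    by rewrite ler_pM2l ?lerDl.
  lra.
have h1 := wM _ st; rewrite yt dotpZl !dotpZr -/D in h1.
have := @convex_function_le _ _ Omega w y z t cw Oy Oz; rewrite t1 ltW// => /(_ isT) h2.
have h3 : t * (dotp q (y - z) - t * (M * D)) <= t * (w y - w z) by lra.
move: h3; rewrite ler_pM2l// => h3.
have : t * P = t * (M * D) + t by rewrite /P; ring.
rewrite /g in tP g0; lra.
Qed.

(** Minimise [w + M * |y - x|^2] on a small box around [x]. For large [M] the minimum point [z] is
    interior, and there a concave paraboloid touches [w] from below. *)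
Lemma subdifferential_nonempty_in (A : set Rn) (w : Rn -> R) :
  {within clO, continuous w} -> convex_function Omega w ->
  open A -> A `<=` Omega -> A !=set0 ->
  exists z q, A z /\ subdifferential Omega w z q.
Proof.
move=> cw cvw oA AO [x Ax].
have /nbhs_ballP[e /= e0 eA] : nbhs x A by apply: open_nbhs_nbhs.
pose r := e / 2; have r0 : 0 < r by rewrite /r; lra.
pose B := box (x - const_mx r) (x + const_mx r).
have Bx y : B y <-> (forall i, `|y 0 i - x 0 i| <= r).
  by split=> h i; have := h i; rewrite !mxE ler_distl.
have BA : B `<=` A.
  move=> y /Bx By; apply: eA; rewrite -ball_normE /= distrC.
  apply: norm_rV_lt => // i; rewrite !mxE (le_lt_trans (By i))// /r; lra.
have B0 : B !=set0 by exists x; apply/Bx => i; rewrite subrr normr0 ltW.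
have cB : compact B by exact: box_compact.
have cwB : {within B, continuous w}.
  by apply: continuous_subspaceW cw => y /BA/AO/subset_closure.
have [m _ mP] := compact_EVT_min B0 cB cwB.
(* Chosen so that [M * r ^+ 2] exceeds the drop of [w] from [x] to its minimum on [B]; this forces
   [Q z < r ^+ 2]. *)
pose M := (w x - w m + 1) / r ^+ 2.
have wxm : w m <= w x by apply: mP; rewrite inE; apply/Bx => i; rewrite subrr normr0 ltW.
have M0 : 0 < M by rewrite divr_gt0 ?exprn_gt0//; lra.
have Mr : M * r ^+ 2 = w x - w m + 1 by rewrite /M divfK// gt_eqF// exprn_gt0.
pose Q (y : Rn) := dotp (y - x) (y - x).
have Qc : continuous Q.
  move=> y; apply: (@cvgr_sum _ _ _ (nbhs y)) => i.
  have cc : (fun y : Rn => (y - x) 0 i) @ nbhs y --> (y - x) 0 i.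
    apply: (@cvg_trans _ ((fun y : Rn => y 0 i - x 0 i) @ nbhs y)).
      by apply: near_eq_cvg; near=> t; rewrite !mxE.
    rewrite !mxE; apply: (@cvgB _ _ _ (nbhs y)); last exact: cvg_cst.
    exact: coord_continuous.
  by apply: (@cvgM _ _ (nbhs y)).
have cg : {within B, continuous (w \- (fun y => - M * Q y))}.
  apply: within_continuousB => //; apply: continuous_within => y.
  by apply: (@cvgM _ _ (nbhs y)); [exact: cvg_cst|exact: Qc].
have [z zB zmin] := compact_EVT_min B0 cB cg.
rewrite inE in zB.
have zP y : B y -> w z + M * Q z <= w y + M * Q y.
  by move=> By; have := zmin y; rewrite inE => /(_ By) /=; lra.
have Qx : Q x = 0.
  by rewrite /Q subrr /dotp big1// => i _; rewrite mxE mul0r.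
have Qz : Q z < r ^+ 2.
  rewrite -(ltr_pM2l M0) Mr.
  have xB : B x by apply/Bx => i; rewrite subrr normr0 ltW.
  have := zP x xB; rewrite Qx mulr0 addr0.
  by have := mP z; rewrite inE => /(_ zB); lra.
have zx : `|x - z| < r.
  rewrite distrC; apply: norm_rV_lt => // i.
  rewrite -(ltr_pXn2r (n := 2))// ?nnegrE ?ltW// real_normK ?num_real//.
  exact: le_lt_trans (sqr_coord_le_dotp _ i) Qz.
have /nbhs_ballP[d /= d0 dB] : nbhs z (ball x r).
  apply: open_nbhs_nbhs; split; first exact: ball_open.
  by rewrite -ball_normE.
(* The slope is the gradient at [z] of the paraboloid [- M * Q]. *)
exists z, ((- 2 * M) *: (z - x)); split; first exact: BA.
apply: (@convex_above_paraboloid w z _ M d) => //; [exact/AO/BA|exact: ltW|].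
move=> y yz; have By : B y.
  have : ball x r y by apply: dB; rewrite -ball_normE/= distrC.
  rewrite -ball_normE/= => xy; apply/Bx => i.
  have := norm_coord_le (y - x) i; rewrite !mxE => /le_trans; apply.
  by rewrite distrC ltW.
have := zP y By.
have -> : Q y = Q z + 2 * dotp (z - x) (y - z) + dotp (y - z) (y - z).
  rewrite /Q [y - x](_ : _ = (z - x) + (y - z)); last by apply/rowP => i; rewrite !mxE; ring.
  move: (z - x) (y - z) => a b.
  by rewrite dotpDl !dotpDr [dotp b a]dotpC; ring.
rewrite dotpZl; lra.
Unshelve. all: by end_near. Qed.

(** Let [q] be a subgradient of [w] at a point [z] of the contact set. Planes through the same point
    of the graph with slopes [q'] close to [q] still slide down to touch [u] inside the set, so the
    subgradient image contains a cube around [q]. *)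
Lemma monge_ampere_contact_gt0 (u w : Rn -> R) (d : R) (x : Rn) :
  {within clO, continuous u} -> {within clO, continuous w} ->
  convex_function Omega w ->
  (forall y, boundary Omega y -> u y = 0) ->
  (forall y, boundary Omega y -> w y <= 0) ->
  0 < d -> Omega x -> u x + d < w x ->
  (0 < monge_ampere Omega u [set y | Omega y /\ (u y + d < w y)%R])%E.
Proof.
move=> cu cw cvw u0 w0 d0 Ox xd.
pose A := [set y | Omega y /\ u y + d < w y].
have [|z [q [[Oz zd] qz]]] := @subdifferential_nonempty_in A w cw cvw
  (contact_open oO cu cw) (fun y Ay => Ay.1); first by exists x.
have lw := subdifferential_closure cw qz.
(* A tilt of at most [mu] over the domain leaves room for the sliding and keeps the touching point
   in [A]. *)
pose mu := Num.min ((w z - u z - d) / 2) d / 2.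
have mu0 : 0 < mu by rewrite /mu divr_gt0// lt_min d0 andbT; lra.
have mu1 : mu <= (w z - u z - d) / 2 / 2 by rewrite /mu ler_pM2r// ge_min lexx.
have mu2 : mu <= d / 2 by rewrite /mu ler_pM2r// ge_min lexx orbT.
have [D D0 DP] : exists2 D : R, 0 < D & forall y, clO y -> `|y - z| <= D.
  have /ex_strict_bound_gt0[D D0 DP] := compact_bounded (bounded_closure_compact bO).
  exists (D + D); first exact: addr_gt0.
  move=> y Cy; rewrite (le_trans (ler_normB _ _))// lerD// ltW// DP//.
  exact: subset_closure.
have N0 : 0 < n.+1%:R * D :> R by rewrite mulr_gt0.
(* By [dotp_le], slopes within [rho + rho] of [q] tilt the plane by at most [mu] over the closure;
   using [n.+1] keeps the divisor positive. *)
pose rho := mu / (n.+1%:R * D) / 2.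
have rho0 : 0 < rho by apply: divr_gt0 => //; exact: divr_gt0.
have rhoE : n.+1%:R * (rho + rho) * D = mu.
  rewrite (_ : _ * D = rho * 2 * (n.+1%:R * D)); last by ring.
  by rewrite /rho divfK// divfK// gt_eqF.
apply: (@lt_le_trans _ _ ((rho + rho) ^+ n)%:E).
  by rewrite lte_fin exprn_gt0// addr_gt0.
apply: (lebesgueRn_cube (c := q - const_mx rho)); first exact: addr_gt0.
move=> q' q'B.
have q'q : `|q' - q| < rho + rho.
  apply: norm_rV_lt => [|i]; first exact: addr_gt0.
  by have := q'B i; rewrite !mxE ltr_norml; lra.
have eb y : clO y -> dotp (q' - q) (y - z) <= mu.
  move=> Cy; apply: le_trans (ler_norm _) _; apply: le_trans (dotp_le _ _) _.
  rewrite -rhoE ler_pM ?mulr_ge0//; last exact: DP.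
  by rewrite ler_pM// ?ler_nat// ltW.
have split y : w z - dotp q' z + dotp q' y =
    w z - dotp q z + dotp q y + dotp (q' - q) (y - z).
  have e x' : dotp q' x' = dotp q x' + dotp (q' - q) x'.
    by rewrite -dotpDl addrC subrK.
  by rewrite !e dotpDr dotpNr; ring.
have [y By||y [Oy qy yd]] :=
  @subdifferential_slide _ _ Omega oO bO u q' (w z - dotp q' z) mu z cu Oz.
- by rewrite split u0//; have := eb _ By.1; have := lw _ By.1; have := w0 _ By; lra.
- lra.
exists y => //; split => //.
have Cy := subset_closure Oy.
have := eb _ Cy; have := lw _ Cy; move: yd; rewrite !split subrr.
rewrite [dotp _ 0](_ : _ = 0); first lra.
by rewrite -(subrr 0) dotpDr dotpNr subrr.
Qed.

End subgradients.

(** * Comparison when some multiple lies below *)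

Section comparison.
Context {R : realType} {n : nat}.
Local Notation Rn := 'rV[R]_n.
Implicit Types (Omega : set Rn).

Lemma open_measurable_borelRn (A : set Rn) : open A ->
  measurable (A : set (borelRn R n)).
Proof. by move=> oA; exact: sub_sigma_algebra. Qed.

Lemma convex_functionI Omega (f : Rn -> R) :
  (forall x y t, Omega x -> Omega y -> 0 <= t <= 1 ->
    f (t *: x + (1 - t) *: y) <= t * f x + (1 - t) * f y) ->
  convex_function Omega f.
Proof.
move=> cf t x y; rewrite !inE => Ox Oy.
by apply: cf => //; rewrite ge0 le1.
Qed.

Lemma convex_functionZ Omega (f : Rn -> R) (t : R) : 0 <= t ->
  convex_function Omega f -> convex_function Omega (fun y => t * f y).
Proof.
move=> t0 cf; apply: convex_functionI => x y s Ox Oy s01.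
have := ler_wpM2l t0 (convex_function_le cf Ox Oy s01).
by rewrite mulrDr !(mulrCA t).
Qed.

Lemma within_continuousZ (K : set Rn) (f : Rn -> R) (t : R) :
  {within K, continuous f} -> {within K, continuous (fun y => t * f y)}.
Proof. by move=> cf x; apply: continuousM; [exact: cst_continuous|exact: cf]. Qed.

Lemma subdifferentialZ Omega (w : Rn -> R) (t : R) x q : 0 <= t ->
  subdifferential Omega w x q ->
  subdifferential Omega (fun y => t * w y) x (t *: q).
Proof.
move=> t0 qx y /qx; rewrite dotpZl -mulrDr; exact: ler_wpM2l.
Qed.

Lemma le_power_density_scale (nu : {measure set (borelRn R n) -> \bar R})
    (u w : Rn -> R) (p s : R) (A : set Rn) :
  0 <= p -> 0 < s ->
  (forall x, A x -> `|u x| <= s * `|w x|) ->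
  (power_density nu u p A <= (s `^ p)%:E * power_density nu w p A)%E.
Proof.
move=> p0 s0 us.
have sp : 0 < s `^ p by exact: powR_gt0.
rewrite -lee_pdivrMl//.
have := @le_integral_bijection _ (borelRn R n) R nu nu id id A
  (fun x => `|u x| `^ p) (fun x => `|w x| `^ p) (s `^ p)^-1 1.
rewrite mulr1; apply => //; rewrite ?measure0//.
- by rewrite invr_gt0.
- move=> x Ax; rewrite ler_pdivrMl// -powRM ?(ltW s0)//.
  by apply: ge0_ler_powR; rewrite ?nnegrE ?mulr_ge0 ?(ltW s0)//; exact: us.
- by move=> B _ _; rewrite mul1e.
Qed.

Lemma powR_split (s p : R) : 1 < s -> p < n%:R -> (0 < n)%N ->
  exists t, [/\ 0 < t, t < s & s `^ p < t ^+ n].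
Proof.
move=> s1 pn n0; have n0' : 0 < n%:R :> R by rewrite ltr0n.
have s0 : 0 < s by lra.
have ltr_pow a b : a < b -> s `^ a < s `^ b.
  by move=> ab; rewrite /powR gt_eqF// ltr_expR ltr_pM2r// ln_gt0.
(* Then [t ^+ n] is [s] raised to the midpoint of [p] and [n], hence above [s] raised to [p]. *)
exists (s `^ ((p + n%:R) / 2 / n%:R)); split; first exact: powR_gt0.
  rewrite -[ltRHS]powRr1 ?ltW//; apply: ltr_pow.
  by rewrite ltr_pdivrMr// mul1r; lra.
rewrite -powR_mulrn ?powR_ge0// -powRrM divfK ?gt_eqF//.
by apply: ltr_pow; lra.
Qed.

Lemma comparison_of_multiple Omega
    (nu : {measure set (borelRn R n) -> \bar R}) (u w : Rn -> R) (p T : R) :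
  0 < p -> p < n%:R -> open Omega -> bounded_set Omega ->
  {within closure Omega, continuous u} ->
  {within closure Omega, continuous w} ->
  convex_function Omega w ->
  (forall x, Omega x -> w x < 0) ->
  (forall x, boundary Omega x -> w x <= 0) ->
  le_measure_in Omega (power_density nu w p) (monge_ampere Omega w) ->
  (forall x, boundary Omega x -> u x = 0) ->
  le_measure_in Omega (monge_ampere Omega u) (power_density nu u p) ->
  (forall x, Omega x -> T * w x <= u x) ->
  forall x, Omega x -> w x <= u x.
Proof.
move=> p0 pn oO bO cu cw cvw wneg w0 mw u0 mu uT x0 Ox0.
rewrite leNgt; apply/negP => ux0.
have n0 : (0 < n)%N by rewrite -(ltr0n R); lra.
pose E := [set t | forall x, Omega x -> t * w x <= u x].
(* Since [u x0 < w x0 < 0], a factor at most [1] already fails at [x0]. *)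
have E1 t : E t -> 1 < t.
  move=> Et; rewrite ltNge; apply/negP => t1.
  have := Et _ Ox0; have := wneg _ Ox0; nra.
have hE : has_inf E.
  by split; [exists T | exists 1 => t /E1/ltW].
pose s := inf E.
(* The infimum is attained: each point [x] imposes the closed condition [u x / w x <= t]. *)
have Es : E s.
  move=> x Ox; have wx := wneg _ Ox.
  rewrite -ler_ndivrMr//; apply: lb_le_inf; first by exists T.
  by move=> t Et; rewrite ler_ndivrMr//; exact: Et.
have s1 := E1 _ Es.
have [t [t0 ts spt]] := powR_split s1 pn n0.
have nEt : ~ E t.
  move=> Et; suff : s <= t by rewrite leNgt ts.
  by apply: ge_inf => //; exact: hE.2.
have [x [Ox xt]] : exists x, Omega x /\ u x < t * w x.
  apply: contrapT => nex; apply: nEt => x Ox; rewrite leNgt; apply/negP => ux.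
  by apply: nex; exists x.
pose W y := t * w y; pose d := (W x - u x) / 2.
have d0 : 0 < d by rewrite /d /W; lra.
pose A := [set y | Omega y /\ u y + d < W y].
have AO : A `<=` Omega by move=> y [].
have cW : {within closure Omega, continuous W} by exact: within_continuousZ.
have cvW : convex_function Omega W by apply: convex_functionZ => //; exact: ltW.
have W0 y : boundary Omega y -> W y <= 0.
  by move=> By; have := w0 _ By; rewrite /W; nra.
have mA : measurable (A : set (borelRn R n)).
  by apply: open_measurable_borelRn; exact: contact_open.
have muA0 : (0 < monge_ampere Omega u A)%E.
  have xd : u x + d < W x by rewrite /d /W; lra.
  exact: (monge_ampere_contact_gt0 oO bO cu cW cvW u0 W0 d0 Ox xd).
pose X := monge_ampere Omega w A.
(* [A] lies in the compact set [u <= W - d], which avoids the boundary because [W - d < 0 = u]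
   there. *)
have Xfin : (X < +oo)%E.
  pose C := [set y | closure Omega y /\ u y <= (fun z => W z - d) y].
  have cC : compact C.
    apply: (subclosed_compact _ (bounded_closure_compact bO)); last by move=> y [].
    apply: within_le_closed => //; first exact: closed_closure.
    apply: (within_continuousB (g := fun=> d)) => //.
    exact/continuous_within/cst_continuous.
  have CO : C `<=` Omega.
    move=> y [Cy]; have [//|By] := closure_boundary oO Cy.
    by rewrite u0//; have := W0 _ By; lra.
  apply: le_lt_trans (subdifferential_bounded oO bO n0 cw cC CO).
  apply: le_lebesgueRn => q [y [Oy Ay] qy]; exists y => //; split; last by lra.
  exact: subset_closure.
have lower : ((t ^+ n)%:E * X <= monge_ampere Omega u A)%E.
  apply: le_trans (lebesgueRn_affine 0 _ t0) _.
  apply: le_lebesgueRn => _ [q [y [Oy Ay] qy] <-]; rewrite addr0.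
  have := subdifferential_contact oO bO (ltW d0) cu cW u0 W0 Oy Ay.
  by move=> /(_ _ (subdifferentialZ (ltW t0) qy))[z [Oz Az qz]]; exists z.
(* On [A] both functions are negative and [s * w <= u], so [|u| <= s * |w|]. *)
have upper : (monge_ampere Omega u A <= (s `^ p)%:E * X)%E.
  apply: le_trans (mu _ mA AO) _.
  apply: (@le_trans _ _ ((s `^ p)%:E * power_density nu w p A)%E).
    apply: le_power_density_scale => //; [exact: ltW|lra|move=> y [Oy Ay]].
    have wy := wneg _ Oy; have := Es _ Oy.
    rewrite (ltr0_norm wy) ltr0_norm; first lra.
    by move: Ay; rewrite /W; nra.
  by rewrite lee_pmul2l ?lte_fin ?powR_gt0//; [exact: mw|lra].
have X0 : (0 < X)%E.
  have := lt_le_trans muA0 upper.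
  by rewrite pmule_rgt0// lte_fin powR_gt0//; lra.
have Xf : X \is a fin_num by rewrite ge0_fin_numE// ltW.
have := le_trans lower upper; rewrite lee_pmul2r// lee_fin.
by rewrite leNgt spt.
Qed.

End comparison.

(** * Compactly supported measures *)

Section supports.
Context {R : realType} {n : nat}.
Local Notation Rn := 'rV[R]_n.
Implicit Types (Omega : set Rn) (nu : {measure set (borelRn R n) -> \bar R}).

(** Measurable subsets of [A] are null, so on [A] the measure [nu] is dominated by [mzero], whose
    integrals vanish. *)
Lemma power_density_null nu (u : Rn -> R) (p : R) (A : set Rn) :
  measurable (A : set (borelRn R n)) -> nu A = 0%E ->
  (power_density nu u p A <= 0)%E.
Proof.
move=> mA nuA.
have := @le_integral_bijection _ (borelRn R n) R nu mzero id id A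
  (fun x => `|u x| `^ p) (fun x => `|u x| `^ p) 1 1.
rewrite integral_measure_zero mulr1 mul1e; apply => //.
- by move=> x _; rewrite mul1r.
- by move=> B mB BA; rewrite (subset_measure0 mB mA BA nuA) mule0.
Qed.

(** An open set is a countable union of compact sets, and each of these is covered by finitely many
    of the null pieces. *)
Lemma locally_null_measure0 nu (A : set Rn) : open A ->
  (forall x, A x -> exists U : set Rn, [/\ open U, U x & nu (U `&` A) = 0%E]) ->
  nu A = 0%E.
Proof.
move=> oA loc; have mA := open_measurable_borelRn oA.
have /choice[U UP] x : exists U : set Rn, A x -> [/\ open U, U x & nu (U `&` A) = 0%E].
  have [Ax|nAx] := pselect (A x); last by exists set0.
  by have [U UP] := loc x Ax; exists U.
(* The sets [C k] form a compact exhaustion of [A]. *)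
pose far k := [set x | forall y, `|x - y| < k.+1%:R^-1 -> A y].
pose C (k : nat) := box (- const_mx k%:R) (const_mx k%:R) `&` far k.
have cC k : compact (C k).
  apply: compact_closedI; first exact: box_compact.
  rewrite -openC (_ : ~` _ = \bigcup_(y in ~` A) ball y k.+1%:R^-1).
    by apply: bigcup_open => y _; exact: ball_open.
  apply/seteqP; split=> [x /= /existsNP[y /not_implyP[xy nAy]]|x [y nAy] xy].
    by exists y => //; rewrite -ball_normE/= distrC.
  by move/(_ y) => /= h; apply: nAy; apply: h; move: xy; rewrite -ball_normE/= distrC.
have CA k x : C k x -> A x.
  by move=> [_ /(_ x)]; apply; rewrite subrr normr0.
have negC k : nu.-negligible (C k : set (borelRn R n)).
  have := cC k; rewrite compact_cover => /(_ _ (C k) U)[x /CA/UP[]//|x Cx|D DC Dcov].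
    by exists x => //; have [] := UP _ (CA _ _ Cx).
  pose s := finmap.enum_fset D.
  (* The finite subcover as a sequence padded with empty sets, ready for countable subadditivity. *)
  pose F j := if (j < size s)%N then U (nth 0 s j) `&` A else set0.
  apply: (@negligibleS _ _ _ nu (\bigcup_j F j)).
    move=> x Cx; have [i iD Uix] := Dcov _ Cx.
    have si : (index i s < size s)%N by rewrite index_mem.
    by exists (index i s) => //; rewrite /F si nth_index//; split => //; exact: CA Cx.
  apply: negligible_bigcup => j; rewrite /F; case: ifPn => [js|_]; last exact: negligible_set0.
  have := DC _ (mem_nth 0 js); rewrite inE => /CA/UP[oU _ nuU]; apply/negligibleP => //.
  by apply: open_measurable_borelRn; exact: openI.
apply: measure_negligible => //.
apply: (@negligibleS _ _ _ nu (\bigcup_k C k)); last exact: negligible_bigcup.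
move=> x Ax; have /nbhs_ballP[e /= e0 eA] : nbhs x A by exact: open_nbhs_nbhs.
have [k [ke kx]] : exists k : nat, k.+1%:R^-1 < e /\ `|x| <= k%:R.
  near \oo => k; exists k; split; near: k.
    exact: (near_infty_natSinv_lt (PosNum e0)).
  exact: nbhs_infty_ger.
exists k => //; split => [i|y xy].
  by rewrite !mxE -ler_norml; apply: le_trans kx; exact: norm_coord_le.
by apply: eA; rewrite -ball_normE/=; exact: lt_trans ke.
Unshelve. all: by end_near. Qed.

Lemma measure_off_support nu Omega (A : set Rn) : open Omega -> open A ->
  A `<=` Omega -> A `&` support_in Omega nu = set0 -> nu A = 0%E.
Proof.
move=> oO oA AO AK; apply: locally_null_measure0 => // x Ax.
have : ~ support_in Omega nu x.
  by move=> Kx; have : (A `&` support_in Omega nu) x by []; rewrite AK.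
move=> /not_andP[/(_ (AO _ Ax))//|].
move=> /existsNP[U /not_implyP[oU /not_implyP[Ux nU]]].
exists U; split => //; apply/eqP; rewrite eq_le measure_ge0 andbT.
apply: (@le_trans _ _ (nu (U `&` Omega))); last by rewrite leNgt; exact/negP.
apply: le_measure; rewrite ?inE; [| |exact: setIS];
  by apply: open_measurable_borelRn; exact: openI.
Qed.

Lemma exists_multiple_le (K : set Rn) (u w : Rn -> R) (M : R) :
  compact K -> {within K, continuous w} -> (forall x, K x -> w x < 0) ->
  (forall x, K x -> - M <= u x) -> exists2 T, 0 < T &
  forall x, K x -> T * w x <= u x.
Proof.
move=> cK cw wneg uM.
have [[x0 Kx0]|K0] := pselect (K !=set0); last first.
  by exists 1 => // x Kx; case: K0; exists x.
have [c] := compact_EVT_max (ex_intro _ x0 Kx0) cK cw.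
rewrite inE => Kc cmax; have wc := wneg _ Kc.
(* On [K], [w] is at most its maximum [w c < 0], so this factor brings it below [- (|M| + 1)]; the
   [1] keeps the factor positive. *)
exists ((`|M| + 1) / - w c).
  by rewrite divr_gt0 ?oppr_gt0// ltr_wpDl.
move=> x Kx; have := cmax x; rewrite inE => /(_ Kx) wx.
apply: le_trans (uM _ Kx).
rewrite invrN mulrN mulNr lerN2 -mulrA [_^-1 * _]mulrC.
have h : 1 <= w x / w c by rewrite ler_ndivlMr// mul1r.
have := ler_norm M; have : 0 <= `|M| by [].
nra.
Qed.

Lemma within_continuous_bounded (K : set Rn) (u : Rn -> R) : compact K ->
  {within K, continuous u} -> exists M, forall x, K x -> - M <= u x.
Proof.
move=> cK cu.
have /ex_strict_bound_gt0[M M0 MP] : bounded_set (u @` K).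
  exact/compact_bounded/continuous_compact.
exists M => x Kx; have := MP (u x) (imageP _ Kx).
by move=> /ltW; rewrite ler_norml => /andP[].
Qed.

Lemma exists_multiple_compact_support Omega nu (u v : Rn -> R) (p : R) :
  open Omega -> bounded_set Omega ->
  {within closure Omega, continuous u} ->
  {within closure Omega, continuous v} ->
  convex_function Omega v ->
  (forall x, Omega x -> v x < 0) ->
  (forall x, boundary Omega x -> v x <= 0) ->
  (forall x, boundary Omega x -> u x = 0) ->
  le_measure_in Omega (monge_ampere Omega u) (power_density nu u p) ->
  compact (support_in Omega nu) ->
  exists T, forall x, Omega x -> T * v x <= u x.
Proof.
move=> oO bO cu cv cvv vneg v0 u0 mu cK.
have KO x : support_in Omega nu x -> Omega x by case.
have KcO : support_in Omega nu `<=` closure Omega.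
  by move=> x /KO; exact: subset_closure.
have [M MP] := within_continuous_bounded (bounded_closure_compact bO) cu.
have [T T0 TP] := exists_multiple_le cK (continuous_subspaceW KcO cv)
  (fun x Kx => vneg x (KO x Kx)) (fun x Kx => MP x (KcO x Kx)).
exists T => x Ox; rewrite leNgt; apply/negP => xT.
pose W y := T * v y; pose d := (W x - u x) / 2.
have d0 : 0 < d by rewrite /d /W; lra.
have cW : {within closure Omega, continuous W} by exact: within_continuousZ.
have cvW : convex_function Omega W by apply: convex_functionZ => //; exact: ltW.
have W0 y : boundary Omega y -> W y <= 0.
  by move=> By; have := v0 _ By; rewrite /W; nra.
have xd : u x + d < W x by rewrite /d /W; lra.
have := monge_ampere_contact_gt0 oO bO cu cW cvW u0 W0 d0 Ox xd.
set A := [set y | _]; have oA : open (A : set Rn) by exact: contact_open.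
have AO : A `<=` Omega by move=> y [].
have mA := open_measurable_borelRn oA.
(* On the support [T * v <= u], so the contact set [A] misses it and is [nu]-null; this contradicts
   the positivity of the Monge--Ampère measure of [u] on [A]. *)
rewrite ltNge => /negP; apply; apply: le_trans (mu _ mA AO) _.
apply: power_density_null => //; apply: (measure_off_support oO oA AO).
rewrite -subset0 => y [[_ Ay] Ky].
by have := TP _ Ky; rewrite /W in Ay; lra.
Qed.

End supports.

(** * Sign of a convex function with zero boundary values *)

Section nonpositivity.
Context {R : realType} {n : nat}.
Local Notation Rn := 'rV[R]_n.

(* Among the maximum points take one with the largest coordinate [i]; an
   interior maximum propagates along the coordinate line. *)
Lemma convex_le0_of_boundary (Omega : set Rn) (u : Rn -> R) : (0 < n)%N ->
  open Omega -> bounded_set Omega -> {within closure Omega, continuous u} ->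
  convex_function Omega u -> (forall x, boundary Omega x -> u x = 0) ->
  forall x, Omega x -> u x <= 0.
Proof.
move=> n0 oO bO cu cvu u0 x Ox; rewrite leNgt; apply/negP => ux.
pose i := Ordinal n0; have cC := bounded_closure_compact bO.
have Cx : closure Omega x by exact: subset_closure.
have [c] := compact_EVT_max (ex_intro _ x Cx) cC cu.
rewrite inE => Cc cmax.
have umax y : closure Omega y -> u y <= u c by move=> Cy; apply: cmax; rewrite inE.
pose K := [set y | closure Omega y /\ (fun=> u c) y <= u y].
have cK : compact K.
  apply: (subclosed_compact _ cC); last by move=> y [].
  apply: within_le_closed => //; first exact: closed_closure.
  exact/continuous_within/cst_continuous.
have Kc : K c by [].
have ci : {within K, continuous (fun y : Rn => y 0 i)}.
  by apply: continuous_within => y; exact: coord_continuous.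
have [z] := compact_EVT_max (ex_intro _ c Kc) cK ci.
rewrite inE => -[Cz uz] zmax.
have Oz : Omega z.
  have [//|Bz] := closure_boundary oO Cz.
  by have := umax _ Cx; have := u0 _ Bz; lra.
have /nbhs_ballP[e /= e0 eO] : nbhs z Omega by exact: open_nbhs_nbhs.
have Oe s : `|s| = e / 2 -> Omega (z + s *: delta_mx 0 i).
  move=> se; apply: eO; rewrite -ball_normE/= opprD addrA subrr sub0r normrN.
  by rewrite (le_lt_trans (norm_delta_le _ _))// se; lra.
have e2 : 0 < e / 2 by lra.
have Op := Oe _ (gtr0_norm e2).
have Om : Omega (z + (- (e / 2)) *: delta_mx 0 i).
  by apply: Oe; rewrite normrN gtr0_norm.
have := @convex_function_le _ _ Omega u _ _ (1 / 2) cvu Op Om.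
have -> : (1 / 2) *: (z + (e / 2) *: delta_mx 0 i) +
    (1 - 1 / 2) *: (z + (- (e / 2)) *: delta_mx 0 i) = z.
  by apply/rowP => j; rewrite !mxE; lra.
have h01 : 0 <= (1 / 2 : R) <= 1 by apply/andP; split; lra.
move=> /(_ h01) hz.
have up := umax _ (subset_closure Op); have um := umax _ (subset_closure Om).
have Kp : K (z + (e / 2) *: delta_mx 0 i).
  by split; [exact: subset_closure|lra].
have := zmax (z + (e / 2) *: delta_mx 0 i); rewrite inE => /(_ Kp).
by rewrite !mxE !eqxx/=; lra.
Qed.

End nonpositivity.

(** * Dilations about an interior point *)

Section dilation.
Context {R : realType} {n : nat}.
Local Notation Rn := 'rV[R]_n.
Variables (Omega : set Rn) (x0 : Rn).
Hypotheses (oO : open Omega) (bO : bounded_set Omega) (cO : convex_set Omega).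
Hypothesis (Ox0 : Omega x0).
Local Notation clO := (closure Omega).

Definition dilate (s : R) (x : Rn) : Rn := x0 + s *: (x - x0).

Lemma dilateK s : s != 0 -> cancel (dilate s) (dilate s^-1).
Proof.
move=> s0 x; rewrite /dilate [x0 + _ - x0]addrC addKr scalerA mulVf// scale1r.
by rewrite addrC subrK.
Qed.

Lemma dilateVK s : s != 0 -> cancel (dilate s^-1) (dilate s).
Proof. by move=> s0; rewrite -{2}[s]invrK; apply: dilateK; rewrite invr_neq0. Qed.

Lemma continuous_dilate s : continuous (dilate s).
Proof.
move=> x; apply: (@cvgD _ _ _ (nbhs x)); first exact: cvg_cst.
apply: (@cvgZl_tmp _ _ _ (nbhs x)).
by apply: (@cvgB _ _ _ (nbhs x)); [exact: cvg_id|exact: cvg_cst].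
Qed.

Lemma measurable_dilate s :
  measurable_fun [set: borelRn R n] (dilate s : borelRn R n -> borelRn R n).
Proof.
apply: (@measurability _ _ (borelRn R n) (borelRn R n) setT (dilate s) (@open Rn)).
  by [].
move=> _ [U oU <-]; rewrite setTI; apply: sub_sigma_algebra.
by apply: open_comp oU => x _; exact: continuous_dilate.
Qed.

(** Replace [x] by a nearby [y] in [Omega]. The error is moved to the centre, which carries weight
    [1 - s] and may vary in a ball inside [Omega]; convexity concludes. *)
Lemma dilate_in s x : 0 <= s < 1 -> clO x -> Omega (dilate s x).
Proof.
move=> /andP[s0 s1] Cx.
have /nbhs_ballP[e /= e0 eO] : nbhs x0 Omega by exact: open_nbhs_nbhs.
have t0 : 0 < 1 - s by lra.
have /Cx[y [Oy xy]] : nbhs x (ball x (e * (1 - s))).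
  by apply: nbhsx_ballx; rewrite mulr_gt0.
rewrite (_ : dilate s x = s *: y + (1 - s) *: (x0 + (s / (1 - s)) *: (x - y))).
  apply: convex_set_conv => //; last lra.
  apply: eO; rewrite -ball_normE/= opprD addrA subrr sub0r normrN normrZ.
  move: xy; rewrite -ball_normE/= => xy.
  rewrite ger0_norm; last by rewrite divr_ge0// ltW.
  rewrite mulrAC ltr_pdivrMr//; apply: le_lt_trans xy.
  by rewrite ler_piMl// ltW.
rewrite scalerDr scalerA mulrCA mulfV ?gt_eqF// mulr1 /dilate.
by apply/rowP => i; rewrite !mxE; ring.
Qed.

Lemma continuous_at_interior (v : Rn -> R) x :
  {within clO, continuous v} -> Omega x -> {for x, continuous v}.
Proof.
move=> cv Ox; have Cx := subset_closure Ox.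
move/subspace_continuousP : cv => /(_ x Cx); rewrite within_interior//.
apply: (@interiorS _ Omega); first exact: subset_closure.
by rewrite ((interior_id Omega).1 oO).
Qed.

Lemma continuous_dilate_within (v : Rn -> R) s : 0 <= s < 1 ->
  {within clO, continuous v} -> {within clO, continuous (v \o dilate s)}.
Proof.
move=> s01 cv; apply/subspace_continuousP => x Cx.
apply: cvg_within_filter; apply: (@continuous_comp _ _ _ (dilate s) v).
  exact: continuous_dilate.
by apply: continuous_at_interior => //; exact: dilate_in.
Qed.

Lemma convex_function_dilate (v : Rn -> R) s : 0 <= s < 1 ->
  convex_function Omega v -> convex_function Omega (v \o dilate s).
Proof.
move=> s01 cv; apply: convex_functionI => x y t Ox Oy t01 /=.
rewrite (_ : dilate s _ = t *: dilate s x + (1 - t) *: dilate s y).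
  by apply: (convex_function_le cv) => //; apply: dilate_in => //; exact: subset_closure.
by apply/rowP => i; rewrite /dilate !mxE; ring.
Qed.

Lemma subdifferential_dilate (v : Rn -> R) s x q : 0 <= s < 1 ->
  subdifferential Omega v (dilate s x) q ->
  subdifferential Omega (v \o dilate s) x (s *: q).
Proof.
move=> s01 qx y Oy /=.
have := qx _ (dilate_in s01 (subset_closure Oy)).
rewrite (_ : dilate s y - dilate s x = s *: (y - x)) ?dotpZr ?dotpZl//.
by apply/rowP => i; rewrite /dilate !mxE; ring.
Qed.

(** The neighbourhood is joint in the point and the factor, the form that the compactness argument
    of [dilate_near_le] takes. *)
Lemma dilate_near_gt (g : Rn -> R) (a : R) x :
  {within clO, continuous g} -> clO x -> a < g x ->
  \forall y \near x & s \near (1:R)^'-, clO y -> a < g (dilate s y).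
Proof.
move=> cg Cx ax.
have cga : {within clO, continuous (fun y => g y - a)}.
  apply: (within_continuousB (g := fun=> a)) => //.
  exact/continuous_within/cst_continuous.
have := within_gt0 cga Cx; rewrite subr_gt0 => /(_ ax)/nbhs_ballP[e /= e0 eg].
pose K := `|x - x0| + 1; have K0 : 0 < K by rewrite ltr_wpDl.
pose r := Num.min (e / 2) 1; have r0 : 0 < r by rewrite lt_min divr_gt0/=.
have re : r <= e / 2 by rewrite ge_min lexx.
have r1 : r <= 1 by rewrite ge_min lexx orbT.
exists (ball x r, [set s | [/\ 0 < s, s < 1 & 1 - s < e / 2 / K]]) => /=.
  split; first exact: nbhsx_ballx.
  near=> s; split; near: s.
  - exact: nbhs_left_gt.
  - exact: nbhs_left_lt.
  - by apply: nbhs_left_ltBl; rewrite !divr_gt0.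
move=> [y s] /= [xy [s0 s1 se]] Cy.
rewrite -subr_gt0; apply: eg; last first.
  by apply/subset_closure/dilate_in => //; rewrite ltW.
move: xy; rewrite -!ball_normE/= => xy.
have -> : x - dilate s y = (x - y) + (1 - s) *: (y - x0).
  by apply/rowP => i; rewrite /dilate !mxE; ring.
rewrite (le_lt_trans (ler_normD _ _))// [e]splitr ltr_leD//.
  exact: lt_le_trans re.
rewrite normrZ gtr0_norm; last lra.
have yK : `|y - x0| <= K.
  rewrite (le_trans (ler_distD x _ _))// addrC lerD// distrC ltW//.
  exact: lt_le_trans r1.
move: se; rewrite ltr_pdivlMr// => /ltW; apply: le_trans.
by apply: ler_wpM2l => //; lra.
Unshelve. all: by end_near. Qed.

Lemma dilate_near_le (f : Rn -> R) (k : R) : k < 1 ->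
  {within clO, continuous f} -> (forall x, clO x -> 0 < f x) ->
  \forall s \near (1:R)^'-, forall x, clO x -> k * f x <= f (dilate s x).
Proof.
move=> k1 cf fpos.
have /compact_near_coveringP cov := bounded_closure_compact bO.
suff h : \forall s \near (1:R)^'-,
    clO `<=` [set x | clO x -> k * f x <= f (dilate s x)].
  by apply: filterS h => s sP x Cx; exact: sP.
apply: cov => x Cx.
(* A constant strictly between [k * f x] and [f x] separates [k * f y] from [f (dilate s y)] for [y]
   near [x] and [s] near [1]; compactness makes this uniform. *)
pose a := (k * f x + f x) / 2.
have fx := fpos _ Cx.
have ka : k * f x < a by rewrite /a; nra.
have af : a < f x by rewrite /a; nra.
have n1 := dilate_near_gt cf Cx af.
have ck : {within clO, continuous (fun y => a - k * f y)}.
  apply: (within_continuousB (f := fun=> a)); last exact: within_continuousZ.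
  exact/continuous_within/cst_continuous.
have := within_gt0 ck Cx; rewrite subr_gt0 => /(_ ka) n2.
case: n1 => -[A B] [/= nA nB] AB.
exists (A `&` [set y | clO y -> 0 < a - k * f y], B) => /=.
  by split => //; exact: filterI.
move=> [y s] /= [[Ay ky] Bs] Cy.
have := ky Cy; rewrite subr_gt0 => /ltW/le_trans; apply.
by have /(_ Cy)/ltW := AB (y, s) (conj Ay Bs).
Qed.

End dilation.

(** * Positive continuous densities *)

Section dilated_supersolution.
Context {R : realType} {n : nat}.
Local Notation Rn := 'rV[R]_n.
Variables (Omega : set Rn) (x0 : Rn).
Hypotheses (oO : open Omega) (cO : convex_set Omega) (Ox0 : Omega x0).
Local Notation clO := (closure Omega).
Variable nu : {measure set (borelRn R n) -> \bar R}.

Lemma preimage_dilate_subset s (S : set Rn) : 0 < s < 1 -> S `<=` Omega ->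
  dilate x0 s^-1 @^-1` S `<=` Omega.
Proof.
move=> /andP[s0 s1] SO y /SO Oy; rewrite -(dilateVK x0 (lt0r_neq0 s0) y).
by apply: (dilate_in oO cO Ox0); [rewrite ltW | exact: subset_closure].
Qed.

Lemma measurable_preimage_dilate s (S : set (borelRn R n)) : measurable S ->
  measurable (dilate x0 s @^-1` S : set (borelRn R n)).
Proof. by move=> mS; rewrite -[X in measurable X]setTI; exact: measurable_dilate. Qed.

(** The preimage under the inverse dilation is the dilated set: its Lebesgue measure gains [s ^+ n],
    and the density loses at most the factor [k]. *)
Lemma density_dilate (f : Rn -> R) (k s : R) (B : set (borelRn R n)) :
  (0 < n)%N -> 0 < k -> 0 < s < 1 ->
  (forall x, clO x -> 0 < f x) ->
  (forall S : set (borelRn R n), measurable S -> S `<=` Omega ->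
    nu S = (\int[lebesgueRn]_(x in S) (f x)%:E)%E) ->
  (forall x, clO x -> k * f x <= f (dilate x0 s x)) ->
  measurable B -> B `<=` Omega ->
  ((k * s ^+ n)%:E * nu B <= nu (dilate x0 s^-1 @^-1` B))%E.
Proof.
move=> n0 k0 s01 fpos nuE fk mB BO; have /andP[s0 s1] := s01.
rewrite !nuE//; [| exact: measurable_preimage_dilate | exact: preimage_dilate_subset].
apply: (@le_integral_bijection _ (borelRn R n) R lebesgueRn lebesgueRn
  (dilate x0 s) (dilate x0 s^-1) B f f) => //.
- exact: lebesgueRn0.
- exact: lebesgueRn0.
- exact: lebesgueRn_ge0.
- by apply: dilateK; rewrite gt_eqF.
- by apply: dilateVK; rewrite gt_eqF.
- exact: measurable_dilate.
- exact: exprn_gt0.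
- by move=> x /BO Ox; apply/ltW/fpos/subset_closure.
- by move=> x /BO Ox; apply/fk/subset_closure.
move=> A mA AB; apply: le_trans (lebesgueRn_affine (x0 - s *: x0) _ s0) _.
apply: le_lebesgueRn => _ [x Ax <-] /=.
rewrite (_ : s *: x + _ = dilate x0 s x) ?dilateK ?gt_eqF//.
by apply/rowP => i; rewrite /dilate !mxE; ring.
Qed.

(** In the numerical condition, [(l * s) ^+ n] comes from the subgradients of [w], which contain
    [l * s] times those of [v]; the inverse power of [l] from [|w|^p]; and [k * s ^+ n] from the
    dilation of [nu]. *)
Lemma supersolution_dilate (v : Rn -> R) (p l k s : R) :
  0 <= p -> 0 < l -> 0 < k -> 0 < s < 1 ->
  le_measure_in Omega (power_density nu v p) (monge_ampere Omega v) ->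
  (forall B : set (borelRn R n), measurable B -> B `<=` Omega ->
    ((k * s ^+ n)%:E * nu B <= nu (dilate x0 s^-1 @^-1` B))%E) ->
  1 <= (l * s) ^+ n * ((l `^ p)^-1 * (k * s ^+ n)) ->
  let w x := l * v (dilate x0 s x) in
  le_measure_in Omega (power_density nu w p) (monge_ampere Omega w).
Proof.
move=> p0 l0 k0 s01 mv nuk coef w S mS SO; have /andP[s0 s1] := s01.
have s01' : 0 <= s < 1 by rewrite ltW.
pose S' := dilate x0 s^-1 @^-1` S.
have ls0 : 0 < l * s by exact: mulr_gt0.
have wS' : (((l * s) ^+ n)%:E * monge_ampere Omega v S' <= monge_ampere Omega w S)%E.
  apply: le_trans (lebesgueRn_affine 0 _ ls0) _.
  apply: le_lebesgueRn => _ [q [y Sy qy] <-]; rewrite addr0 -scalerA.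
  exists (dilate x0 s^-1 y) => //; apply: subdifferentialZ; first exact: ltW.
  apply: (subdifferential_dilate oO cO Ox0) => //.
  by rewrite dilateVK// gt_eqF.
apply: le_trans wS'.
have vS' := mv _ (measurable_preimage_dilate s^-1 mS) (preimage_dilate_subset s01 SO).
have nS' : (((l `^ p)^-1 * (k * s ^+ n))%:E * power_density nu w p S <=
    power_density nu v p S')%E.
  apply: (@le_integral_bijection _ (borelRn R n) R nu nu
    (dilate x0 s) (dilate x0 s^-1) S (fun x => `|w x| `^ p)
    (fun x => `|v x| `^ p)) => //.
  - by apply: dilateK; rewrite gt_eqF.
  - by apply: dilateVK; rewrite gt_eqF.
  - exact: measurable_dilate.
  - by rewrite invr_gt0 powR_gt0.
  - by rewrite mulr_gt0// exprn_gt0.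
  - by move=> x _; rewrite normrM (gtr0_norm l0) powRM ?(ltW l0)// mulKf// gt_eqF// powR_gt0.
  - by move=> B mB BS; apply: nuk => //; exact: subset_trans SO.
have pd0 : (0 <= power_density nu w p S)%E.
  by apply: integral_ge0 => x _; rewrite lee_fin powR_ge0.
apply: (@le_trans _ _ (((l * s) ^+ n * ((l `^ p)^-1 * (k * s ^+ n)))%:E *
    power_density nu w p S)%E).
  by rewrite lee_pemull// lee_fin.
rewrite EFinM -muleA lee_pmul2l ?lte_fin ?exprn_gt0//.
exact: le_trans nS' vS'.
Qed.

Lemma comparison_density (u v : Rn -> R) (p : R) :
  0 < p -> p < n%:R -> bounded_set Omega ->
  has_positive_continuous_density Omega nu ->
  {within clO, continuous u} -> {within clO, continuous v} ->
  convex_function Omega v ->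
  (forall x, Omega x -> v x < 0) ->
  le_measure_in Omega (power_density nu v p) (monge_ampere Omega v) ->
  (forall x, boundary Omega x -> u x = 0) ->
  le_measure_in Omega (monge_ampere Omega u) (power_density nu u p) ->
  forall x, Omega x -> v x <= u x.
Proof.
move=> p0 pn bO [f [cf fpos nuE]] cu cv cvv vneg mv u0 mu x Ox.
rewrite leNgt; apply/negP => ux.
have n0 : (0 < n)%N by rewrite -(ltr0n R); lra.
have vx := vneg _ Ox.
(* With this factor [l * v x] is the midpoint of [u x] and [v x]; as [u x < v x < 0], it follows
   that [l > 1]. *)
pose l := (u x + v x) / (2 * v x).
have lv : l * v x = (u x + v x) / 2.
  by rewrite /l invfM mulrA divfK// lt_eqF.
have l1 : 1 < l by nra.
have l0 : 0 < l by lra.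
(* Half of the exponent gap: [l] to the power [n - p], times [k * k], equals [1]. One factor [k]
   pays for the density and the other for [s ^+ (n + n)]. *)
pose a := (n%:R - p) / 2; have a0 : 0 < a by rewrite /a; lra.
pose k := l `^ (- a).
have k0 : 0 < k by exact: powR_gt0.
have k1 : k < 1.
  by rewrite /k /powR gt_eqF// expR_lt1 mulNr oppr_lt0 mulr_gt0// ln_gt0.
(* All these strict conditions hold at [s = 1] and persist for [s] slightly below it; the last one
   gives [u x < w x]. *)
have [s [[s0 s1] sk fk sx]] : exists s : R, [/\ 0 < s /\ s < 1,
    k < s ^+ (n + n),
    (forall y, clO y -> k * f y <= f (dilate x0 s y)) &
    u x / l < v (dilate x0 s x)].
  have Cx := subset_closure Ox.
  have uv : u x / l < v x by rewrite ltr_pdivrMr//; lra.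
  have nx := dilate_near_gt oO cO Ox0 cv Cx uv.
  have {}nx : \forall s \near (1:R)^'-, u x / l < v (dilate x0 s x).
    case: nx => -[A B] [/= nA nB] AB.
    apply: filterS nB => s Bs.
    exact: (AB (x, s) (conj (nbhs_singleton nA) Bs)).
  have nf := dilate_near_le oO bO cO Ox0 k1 cf fpos.
  have nk : \forall s \near (1:R)^'-, k < s ^+ (n + n).
    apply: (cvgr_gt (F := (1:R)^'-) (1 : R)) => //.
    rewrite -[X in _ --> X](expr1n _ (n + n)).
    apply: cvg_at_left_filter; exact: exprn_continuous.
  near (1:R)^'- => s; exists s; split.
  - by split; near: s; [exact: nbhs_left_gt | exact: nbhs_left_lt].
  - by near: s.
  - by near: s.
  - by near: s.
have s01 : 0 < s < 1 by rewrite s0 s1.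
have s01' : 0 <= s < 1 by rewrite ltW.
pose w y := l * v (dilate x0 s y).
have wneg y : clO y -> w y < 0.
  by move=> Cy; rewrite pmulr_rlt0//; apply: vneg; exact: dilate_in.
have cw : {within clO, continuous w}.
  by apply: within_continuousZ; exact: continuous_dilate_within.
have cvw : convex_function Omega w.
  apply: convex_functionZ; first exact: ltW.
  exact: (convex_function_dilate oO cO Ox0).
have mw : le_measure_in Omega (power_density nu w p) (monge_ampere Omega w).
  apply: (supersolution_dilate (k := k)) => //; first exact: ltW.
    by move=> B; apply: (density_dilate n0 k0 s01 fpos nuE fk).
  rewrite exprMn -[l ^+ n]powR_mulrn ?(ltW l0)// -powRN.
  rewrite (_ : _ * _ = l `^ n%:R * l `^ (- p) * k * s ^+ (n + n)); last first.
    by rewrite exprD; ring.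
  rewrite -powRD; last by apply/implyP => _; rewrite gt_eqF.
  apply: (@le_trans _ _ (l `^ (n%:R - p) * k * k)).
    rewrite /k -!powRD; [|by apply/implyP => _; rewrite gt_eqF..].
    by rewrite (_ : _ - a = 0) ?powRr0// /a; lra.
  by rewrite ler_pM2l ?ltW// mulr_gt0// powR_gt0.
have [M MP] := within_continuous_bounded (bounded_closure_compact bO) cu.
have [T T0 TP] := exists_multiple_le (bounded_closure_compact bO) cw wneg MP.
have := comparison_of_multiple p0 pn oO bO cu cw cvw _ _ mw u0 mu _ Ox.
move=> /(_ T) wu.
have : w x <= u x.
  apply: wu => y.
  - by move/subset_closure/wneg.
  - by move=> [Cy _]; exact/ltW/wneg.
  - by move=> /subset_closure; exact: TP.
by move: sx; rewrite ltr_pdivrMr// /w mulrC leNgt => ->.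
Unshelve. all: by end_near. Qed.

End dilated_supersolution.

(** * The comparison principle in both cases *)

Theorem theorem1p5 (R : realType) (n : nat) (p : R)
    (Omega : set 'rV[R]_n) (nu : {measure set (borelRn R n) -> \bar R})
    (u v : 'rV[R]_n -> R) :
  0 < p -> p < n%:R ->
  bounded_convex_domain Omega ->
  has_positive_continuous_density Omega nu \/ compact (support_in Omega nu) ->
  {within closure Omega, continuous u} ->
  {within closure Omega, continuous v} ->
  convex_function Omega u ->
  convex_function Omega v ->
  (forall x, Omega x -> v x < 0) ->
  (forall x, boundary Omega x -> v x <= 0) ->
  le_measure_in Omega (power_density nu v p) (monge_ampere Omega v) ->
  (forall x, boundary Omega x -> u x = 0) ->
  le_measure_in Omega (monge_ampere Omega u) (power_density nu u p) ->
  (forall x, Omega x -> v x <= u x) /\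
  le_measure_in Omega (monge_ampere Omega u) (monge_ampere Omega v).
Proof.
move=> p0 pn [_ oO _ bO cO] nuP cu cv cvu cvv vneg v0 mv u0 mu.
have n0 : (0 < n)%N by rewrite -(ltr0n R); lra.
have vu x : Omega x -> v x <= u x.
  move=> Ox; case: nuP => [dens|cK].
    exact: (comparison_density oO cO Ox p0 pn bO dens cu cv cvv vneg mv u0 mu Ox).
  have [T TP] :=
    exists_multiple_compact_support oO bO cu cv cvv vneg v0 u0 mu cK.
  exact: (comparison_of_multiple p0 pn oO bO cu cv cvv vneg v0 mv u0 mu TP Ox).
split=> // S mS SO.
(* Since [v <= u <= 0], the density [|u|^p] is at most [|v|^p]; the sign of [u] comes from convexity
   and its zero boundary values. *)
apply: le_trans (mu _ mS SO) _; apply: le_trans (mv _ mS SO).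
have := @le_power_density_scale R n nu u v p 1 S (ltW p0) ltr01.
rewrite powR1 mul1e; apply => x /SO Ox; rewrite mul1r.
rewrite !ler0_norm ?lerN2 ?vu//; first by apply/ltW/vneg.
exact: (convex_le0_of_boundary n0 oO bO cu cvu u0 Ox).
Qed.
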